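(* (Cellular cover formula.) Let $\alpha$ be a semiring, $\{S_i\}_{i=1}^k\subseteq\alpha^\circ$ a finite list of contracting elements. Write $S=\bigvee_{i=1}^kS_i$. Then $$\operatorname{Spec}\alpha\{-S\}=\bigcup_{i=1}^k\operatorname{Spec}\alpha\{-S_i\}$$ as subsets of $\operatorname{Spec}\alpha$.
   Context: **Semirings.** A $\mathbb B$-module is an idempotent commutative monoid $(\alpha,\vee,-\infty)$, ordered by $X\le Y\Leftrightarrow X\vee Y=Y$; homomorphisms preserve $\vee$ and $-\infty$. An ideal of $\alpha$ is a downward-closed submodule. A topological $\mathbb B$-module is a $\mathbb B$-module with a non-empty set $\alpha^u$ of ideals (the open ideals), closed under enlargement and finite intersection; continuous homomorphisms are those pulling open ideals back to open ideals. The tensor sum $\alpha\oplus\beta$ is the universal recipient of maps from $\alpha\times\beta$ that are $\mathbb B$-module homomorphisms in each variable, with the finest such topology for which all $X\mapsto X\oplus Y$ and $Y\mapsto X\oplus Y$ are continuous. A topological semiring is a commutative monoid $(\alpha,+,0)$ in topological $\mathbb B$-modules with $\oplus$. It is adic if $\alpha^u$ is stable under addition of ideals. Put $\alpha^\circ=\{X\in\alpha: X\le 0\}$. For an additive set $S\subseteq\alpha$, the free localisation $\alpha[-S]$ is the universal $\alpha$-algebra in which elements of $S$ become additively invertible. $\alpha$ is Tate if $\alpha$ and $\alpha^\circ$ are adic and $\alpha$ is a free localisation of $\alpha^\circ$ at an additive family of open elements (elements $S$ such that $\{X\le S\}$ is an open ideal of $\alpha^\circ$). All semirings here are Tate. An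 admissible bound is $T\in\alpha^\circ$ additively invertible in $\alpha$. For $S\in\alpha^\circ$ and an admissible bound $T$, the bounded localisation $\alpha\to\alpha\{T-S\}$ is the universal $\alpha$-algebra in which $S$ becomes invertible with $-S\le -T$; iterate for finitely many pairs $(T_i,S_i)$. For $T=0$ this is the cellular localisation $\alpha\{-S\}=\alpha/(S=0)$. **Skeleta.** $\mathbf{Sk}^{\mathrm{aff}}$ is the opposite of the category of Tate semirings and continuous homomorphisms. An open immersion in it is a morphism dual to a bounded localisation at finitely many pairs. It is a site with coverings generated by finite families of open immersions that cover for the canonical topology (universally effective-epimorphic families). $\operatorname{Spec}\alpha$ is the sheaf represented by $\alpha$, identified with the sober topological space whose frame of open subsets is the frame of open subobjects of this sheaf (subobjects that are unions of open immersions from representables). In particular each $\operatorname{Spec}\alpha\{-S\}$ is an open subset of $\operatorname{Spec}\alpha$. *)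

(* Defs.v *)
(* Max-plus semirings are carried by the library's comPzSemiRingType (the     *)
(* zero semiring is allowed), and B-modules by nmodType. The dictionary is:   *)
(*        X \/ Y  is  x + y           -oo  is  0                              *)
(*        X + Y   is  x * y           0    is  1                              *)
(* so that a finite supremum is a \sum, "additively invertible" means         *)
(* invertible for *, and "X <= 0" is x <=o 1.                                 *)
From HB Require Import structures.
From mathcomp Require Import all_boot all_algebra.
From mathcomp Require Import boolp classical_sets.
Set Implicit Arguments.
Unset Strict Implicit.
Unset Printing Implicit Defensive.
Local Obligation Tactic := idtac.
Import GRing.Theory.
Local Open Scope classical_set_scope.
Local Open Scope ring_scope.

Definition tle (M : nmodType) (x y : M) : Prop := x + y = y.
Notation "x <=o y" := (tle x y) (at level 70, no associativity) : ring_scope.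

Definition ideal (M : nmodType) (I : set M) : Prop :=
  [/\ I 0,
      forall x y, I x -> I y -> I (x + y) &
      forall x y, x <=o y -> I y -> I x].

Record is_topBmod (M : nmodType) (O : set (set M)) : Prop := {
  topB_idem : forall x : M, x + x = x;
  topB_ideal : forall I, O I -> ideal I;
  topB_nonempty : exists I, O I;
  topB_enlarge : forall I J, O I -> ideal J -> I `<=` J -> O J;
  topB_inter : forall I J, O I -> O J -> O (I `&` J) }.

Definition continuous_for (M N : nmodType) (OM : set (set M)) (ON : set (set N))
    (f : M -> N) : Prop :=
  forall I, ON I -> OM (f @^-1` I).

(* Addition in the semiring is a map out of the tensor sum of A with itself.  *)
(* As the latter has the finest topology for which each x (+) _ is continuous *)
(* (and each _ (+) y), continuity of addition is continuity of every          *)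
(* translation; see [continuous_tensor_sumP].                                 *)
Record topSemiRing := TopSemiRing {
  ts_sort :> comPzSemiRingType;
  ts_open : set (set ts_sort);
  ts_topB : is_topBmod ts_open;
  ts_transl : forall x : ts_sort,
    continuous_for ts_open ts_open (fun y => x * y) }.

Section TensorSum.
Variables (M N T P : nmodType) (OM : set (set M)) (ON : set (set N)).
Variables (OP : set (set P)) (u : M -> N -> T).

Definition tensor_open : set (set T) := [set K | [/\ ideal K,
  forall x, ON ((fun y => u x y) @^-1` K) &
  forall y, OM ((fun x => u x y) @^-1` K)]].

Lemma continuous_tensor_sumP (m : T -> P) :
  (forall I, OP I -> ideal I) -> nmod_morphism m ->
  continuous_for tensor_open OP m <->
    (forall x, continuous_for ON OP (fun y => m (u x y))) /\
    (forall y, continuous_for OM OP (fun x => m (u x y))).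
Proof.
move=> idP [m0 mD]; split=> [mc|[mc1 mc2] I OI].
  by split=> z I /mc [_ h1 h2]; [exact: h1 | exact: h2].
split; [|by move=> x; exact: mc1|by move=> y; exact: mc2].
have [I0 ID Idown] := idP _ OI; split=> /=.
- by rewrite m0.
- by move=> x y Ix Iy; rewrite mD; exact: ID.
- by move=> x y lexy; apply: Idown; rewrite /tle -mD lexy.
Qed.
End TensorSum.

Definition ideal_sum (A : comPzSemiRingType) (I J : set A) : set A :=
  [set z | forall K : set A, ideal K ->
     (forall x y, I x -> J y -> K (x * y)) -> K z].

Definition adic (A : topSemiRing) : Prop :=
  forall I J : set A, ts_open I -> ts_open J -> ts_open (ideal_sum I J).

Record chom (A B : topSemiRing) := CHom {
  hfun :> A -> B;
  hom_add : nmod_morphism hfun;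
  hom_mul : monoid_morphism hfun;
  hom_cont : continuous_for (@ts_open A) (@ts_open B) hfun }.

Lemma hom_ext (A B : topSemiRing) (f g : chom A B) : f =1 g -> f = g.
Proof.
case: f g => [f f1 f2 f3] [g g1 g2 g3] /= /funext fg.
by case: _ / fg in g1 g2 g3 *; congr CHom; exact: Prop_irrelevance.
Qed.

Program Definition hid (A : topSemiRing) : chom A A := @CHom A A (fun x => x) _ _ _.
Next Obligation. by move=> A; split. Qed.
Next Obligation. by move=> A; split. Qed.
Next Obligation. by move=> A I. Qed.

Program Definition hcomp (A B C : topSemiRing) (g : chom B C) (f : chom A B) :
  chom A C := @CHom A C (fun x => g (f x)) _ _ _.
Next Obligation.
move=> A B C g f; have [f0 fD] := hom_add f; have [g0 gD] := hom_add g.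
by split=> [|x y]; rewrite ?f0 ?g0 // fD gD.
Qed.
Next Obligation.
move=> A B C g f; have [f0 fD] := hom_mul f; have [g0 gD] := hom_mul g.
by split=> [|x y]; rewrite ?f0 ?g0 // fD gD.
Qed.
Next Obligation. move=> A B C g f I OI; exact: (@hom_cont _ _ f _ (@hom_cont _ _ g I OI)). Qed.

Lemma hcompA (A B C D : topSemiRing) (h : chom C D) (g : chom B C) (f : chom A B) :
  hcomp h (hcomp g f) = hcomp (hcomp h g) f.
Proof. exact: hom_ext. Qed.

Lemma hcomp1f (A B : topSemiRing) (f : chom A B) : hcomp (hid B) f = f.
Proof. exact: hom_ext. Qed.

Lemma hcompf1 (A B : topSemiRing) (f : chom A B) : hcomp f (hid A) = f.
Proof. exact: hom_ext. Qed.

Definition contracting (A : topSemiRing) : {pred A} := fun x => x + 1 == 1.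
Arguments contracting : clear implicits.

Lemma contractingP (A : topSemiRing) (x : A) :
  reflect (x <=o 1) (x \in contracting A).
Proof. exact: eqP. Qed.

Lemma contracting_closed (A : topSemiRing) : semiring_closed (contracting A).
Proof.
split; split.
- by apply/eqP; rewrite add0r.
- move=> x y /eqP hx /eqP hy; apply/eqP.
  by rewrite -addrA hy.
- by apply/eqP; exact: (topB_idem (ts_topB A)).
- move=> x y /eqP hx /eqP hy; apply/eqP.
  by rewrite -{1}hx addrA -{2}(mulr1 x) -mulrDr hy mulr1.
Qed.

Definition circ_type (A : topSemiRing) := {x : A | x \in contracting A}.
HB.instance Definition _ (A : topSemiRing) :=
  [isSub of circ_type A for sval].
HB.instance Definition _ (A : topSemiRing) := [Choice of circ_type A by <:].
HB.instance Definition _ (A : topSemiRing) :=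
  GRing.SubChoice_isSubComPzSemiRing.Build A (contracting A) (circ_type A)
    (contracting_closed A).

Definition circ_open (A : topSemiRing) : set (set (circ_type A)) :=
  [set J | ideal J /\ exists2 I : set A, ts_open I & val @^-1` I `<=` J].

Lemma circ_topB (A : topSemiRing) : is_topBmod (@circ_open A).
Proof.
have topA := ts_topB A; split.
- by move=> x; apply: val_inj; rewrite raddfD; exact: (topB_idem topA).
- by move=> J [].
- exists setT; split; first by [].
  by have [I OI] := topB_nonempty topA; exists I.
- move=> I J [_ [K OK KI]] idJ IJ; split=> //; exists K => //.
  exact: subset_trans KI IJ.
- move=> I J [[I0 ID Ile] [K OK KI]] [[J0 JD Jle] [L OL LJ]]; split.
    split=> //= [x y [Ix Jx] [Iy Jy]|x y lexy [Iy Jy]].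
      by split; [exact: ID | exact: JD].
    by split; [exact: Ile lexy Iy | exact: Jle lexy Jy].
  exists (K `&` L); first exact: topB_inter OK OL.
  by move=> x [/KI Ix /LJ Jx].
Qed.

Lemma circ_transl (A : topSemiRing) (x : circ_type A) :
  continuous_for (@circ_open A) (@circ_open A) (fun y => x * y).
Proof.
move=> J [[J0 JD Jle] [I OI IJ]]; split.
  split=> /= [|y z Jy Jz|y z lexy]; rewrite ?mulr0 ?mulrDr //; first exact: JD.
  by apply: Jle; rewrite /tle -mulrDr lexy.
exists (fun y => I (val x * y)); first exact: (ts_transl (val x) OI).
by move=> y Iy; apply: IJ.
Qed.

Definition circ (A : topSemiRing) : topSemiRing :=
  @TopSemiRing (circ_type A) _ (circ_topB A) (@circ_transl A).

Program Definition circ_incl (A : topSemiRing) : chom (circ A) A :=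
  @CHom (circ A) A (fun x => val x) _ _ _.
Next Obligation. by move=> A; split. Qed.
Next Obligation. by move=> A; split. Qed.
Next Obligation.
move=> A I OI; have [I0 ID Ile] := topB_ideal (ts_topB A) OI; split; last by exists I.
split=> //= [x y Ix Iy|x y lexy]; first exact: ID.
by apply: Ile; have := congr1 val lexy.
Qed.

Definition tinvertible (A : comPzSemiRingType) (x : A) : Prop :=
  exists y, x * y = 1.

Definition additive_set (A : comPzSemiRingType) (S : set A) : Prop :=
  S 1 /\ forall x y, S x -> S y -> S (x * y).

Definition is_free_localisation (A B : topSemiRing) (f : chom A B) (S : set A) :
    Prop :=
  (forall s, S s -> tinvertible (f s)) /\
  forall (C : topSemiRing) (g : chom A C),
    (forall s, S s -> tinvertible (g s)) -> exists! h : chom B C, hcomp h f = g.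

Definition is_tate (A : topSemiRing) : Prop :=
  [/\ adic A, adic (circ A) &
   exists S : set (circ A),
     [/\ additive_set S,
         forall s, S s -> ts_open [set x | x <=o s] &
         is_free_localisation (circ_incl A) S]].

Record tate := Tate { tate_sort :> topSemiRing; tate_ax : is_tate tate_sort }.

Definition admissible_bound (A : topSemiRing) (t : A) : Prop :=
  t <=o 1 /\ tinvertible t.

(* - x <= - t *)
Definition bounded_inverse (A : topSemiRing) (t x : A) : Prop :=
  exists x' t' : A, [/\ x * x' = 1, t * t' = 1 & x' <=o t'].

(* A -> A{T - S} is only determined up to unique isomorphism *)
Record is_bounded_loc (A B : tate) (f : chom A B) (t s : A) : Prop := {
  bloc_contracting : s <=o 1;
  bloc_bound : admissible_bound t;
  bloc_inv : bounded_inverse (f t) (f s);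
  bloc_univ : forall (C : tate) (g : chom A C), bounded_inverse (g t) (g s) ->
    exists! h : chom B C, hcomp h f = g }.

Definition is_cellular_loc (A B : tate) (f : chom A B) (s : A) : Prop :=
  is_bounded_loc f 1 s.

(* The (duals of) open immersions, i.e. finitely iterated bounded             *)
(* localisations; each pair lives in the semiring reached so far.             *)
Inductive open_immersion : forall A B : tate, chom A B -> Prop :=
| oimm_id (A : tate) : open_immersion (hid A)
| oimm_step (A B C : tate) (f : chom A B) (g : chom B C) (t s : A) :
    is_bounded_loc f t s -> open_immersion g -> open_immersion (hcomp g f).

(* The opposite category is never formed: a presheaf on it is a covariant     *)
(* functor on Tate semirings, and a sieve on Spec A is a set of morphisms     *)
(* out of A that is closed under postcomposition.                             *)
Record presheaf := Presheaf {
  ps_obj :> tate -> Type;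
  ps_map : forall B C : tate, chom B C -> ps_obj B -> ps_obj C;
  ps_map1 : forall (B : tate) (x : ps_obj B), ps_map (hid B) x = x;
  ps_mapM : forall (B C D : tate) (g : chom C D) (f : chom B C) (x : ps_obj B),
    ps_map (hcomp g f) x = ps_map g (ps_map f x) }.

Program Definition Spec (A : tate) : presheaf :=
  @Presheaf (fun B => chom A B) (fun B C g f => hcomp g f) _ _.
Next Obligation. by move=> *; exact: hcomp1f. Qed.
Next Obligation. by move=> *; exact/esym/hcompA. Qed.

Record subpresheaf (F : presheaf) := SubPresheaf {
  sp_in :> forall B : tate, F B -> Prop;
  sp_stable : forall (B C : tate) (g : chom B C) (x : F B),
    sp_in x -> sp_in (ps_map g x) }.

Program Definition presheaf_of (F : presheaf) (U : subpresheaf F) : presheaf :=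
  @Presheaf (fun B => {x : F B | U B x})
    (fun B C g x => exist _ (ps_map g (sval x)) (sp_stable g (svalP x))) _ _.
Next Obligation.
by move=> F U B [x Ux]; apply: eq_exist; exact: ps_map1.
Qed.
Next Obligation.
by move=> F U B C D g f [x Ux]; apply: eq_exist; exact: ps_mapM.
Qed.

Definition subp_le (F : presheaf) (U V : subpresheaf F) : Prop :=
  forall (B : tate) (x : F B), U B x -> V B x.

Definition sieve (A : tate) := subpresheaf (Spec A).

Program Definition sieve_max (A : tate) : sieve A :=
  @SubPresheaf (Spec A) (fun _ _ => True) _.
Next Obligation. by []. Qed.

Program Definition sieve_pull (A B : tate) (f : chom A B) (R : sieve A) : sieve B :=
  @SubPresheaf (Spec B) (fun C g => R C (hcomp g f)) _.
Next Obligation.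
by move=> A B f R C D g x Rx; rewrite /= -hcompA; exact: (sp_stable g Rx).
Qed.

Program Definition sieve_gen (A : tate) (I : Type) (B : I -> tate)
    (f : forall i, chom A (B i)) : sieve A :=
  @SubPresheaf (Spec A) (fun C g => exists i (h : chom (B i) C), hcomp h (f i) = g) _.
Next Obligation.
by move=> A I B f C D g x [i [h <-]]; exists i, (hcomp g h); rewrite /= hcompA.
Qed.

Definition matching (F : presheaf) (A : tate) (R : sieve A)
    (x : forall (B : tate) (f : chom A B), R B f -> F B) : Prop :=
  forall (B C : tate) (f : chom A B) (g : chom B C) (r : R B f)
    (r' : R C (hcomp g f)), ps_map g (x B f r) = x C (hcomp g f) r'.

Definition sheaf_for (F : presheaf) (A : tate) (R : sieve A) : Prop :=
  forall x : (forall (B : tate) (f : chom A B), R B f -> F B), matching x ->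
    exists! y : F A, forall (B : tate) (f : chom A B) (r : R B f),
      ps_map f y = x B f r.

Definition univ_effective_epi (A : tate) (R : sieve A) : Prop :=
  forall (B : tate) (f : chom A B) (C : tate), sheaf_for (Spec C) (sieve_pull f R).

(* The Grothendieck topology generated by the finite families of open         *)
(* immersions that are universally effective-epimorphic                       *)
Inductive covering : forall A : tate, sieve A -> Prop :=
| cov_gen (A : tate) (n : nat) (B : 'I_n -> tate) (f : forall i, chom A (B i)) :
    (forall i, open_immersion (f i)) -> univ_effective_epi (sieve_gen f) ->
    covering (sieve_gen f)
| cov_max (A : tate) : covering (sieve_max A)
| cov_pull (A B : tate) (f : chom A B) (R : sieve A) :
    covering R -> covering (sieve_pull f R)
| cov_trans (A : tate) (R R' : sieve A) : covering R ->
    (forall (B : tate) (f : chom A B), R B f -> covering (sieve_pull f R')) ->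
    covering R'.

Definition is_sheaf (F : presheaf) : Prop :=
  forall (A : tate) (R : sieve A), covering R -> sheaf_for F R.

Definition Spec_image (A B : tate) (f : chom A B) : subpresheaf (Spec A) :=
  sieve_gen (fun _ : unit => f).

(* U is the union of the family F in the lattice of subsheaves of Spec A *)
Definition is_union (A : tate) (F : forall B : tate, chom A B -> Prop)
    (U : subpresheaf (Spec A)) : Prop :=
  [/\ is_sheaf (presheaf_of U),
      forall (B : tate) (f : chom A B), F B f -> subp_le (Spec_image f) U &
      forall V : subpresheaf (Spec A), is_sheaf (presheaf_of V) ->
        (forall (B : tate) (f : chom A B), F B f -> subp_le (Spec_image f) V) ->
        subp_le U V].

Record open_subobject (A : tate) := OpenSubobject {
  os_sub :> subpresheaf (Spec A);
  os_union : exists2 F : forall B : tate, chom A B -> Prop,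
    (forall (B : tate) (f : chom A B), F B f -> open_immersion f) &
    is_union F os_sub }.

(* Subsets of the large types below are bare predicates, as the library's     *)
(* [set] is bound to the universe of the carriers of semirings.               *)
Definition is_join (A : tate) (F : open_subobject A -> Prop)
    (U : open_subobject A) : Prop :=
  (forall V, F V -> subp_le V U) /\
  forall W : open_subobject A, (forall V, F V -> subp_le V W) -> subp_le U W.

(* The points of the sober space with a given frame of opens are the          *)
(* completely prime filters of that frame.                                    *)
Record Spec_point (A : tate) := SpecPoint {
  pt_in : open_subobject A -> Prop;
  pt_inhabited : exists U, pt_in U;
  pt_upward : forall U V : open_subobject A, subp_le U V -> pt_in U -> pt_in V;
  pt_directed : forall U V, pt_in U -> pt_in V ->
    exists W : open_subobject A, [/\ pt_in W, subp_le W U & subp_le W V];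
  pt_prime : forall (F : open_subobject A -> Prop) (U : open_subobject A),
    is_join F U -> pt_in U -> exists2 V, F V & pt_in V }.

Definition open_set (A : tate) (U : open_subobject A) : Spec_point A -> Prop :=
  fun p => pt_in p U.

Lemma bounded_loc_epi (A B C : tate) (f : chom A B) (t s : A) (h k : chom B C) :
  is_bounded_loc f t s -> hcomp h f = hcomp k f -> h = k.
Proof.
move=> fts hk.
have inv : bounded_inverse (hcomp h f t) (hcomp h f s).
  have [x' [t' [xx' tt' le]]] := bloc_inv fts.
  have [h1 hM] := hom_mul h; have [h0 hD] := hom_add h.
  exists (h x'), (h t'); split=> /=; rewrite -?hM ?xx' ?tt' //.
  by rewrite /tle -hD le.
by have [l [_ lu]] := bloc_univ fts inv; rewrite -(lu h) // -(lu k).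
Qed.

Lemma open_immersion_epi (A B : tate) (f : chom A B) : open_immersion f ->
  forall (C : tate) (h k : chom B C), hcomp h f = hcomp k f -> h = k.
Proof.
elim=> [A0 C h k|A0 B0 C f0 g t s fts _ IH D h k].
  by rewrite !hcompf1.
by rewrite !hcompA => /(bounded_loc_epi fts) /IH.
Qed.

Lemma sieve_ext (A : tate) (R R' : sieve A) :
  (forall (B : tate) (f : chom A B), R B f <-> R' B f) -> R = R'.
Proof.
case: R R' => [R Rs] [R' Rs'] /= RR'.
have e : R = R' by apply: functional_extensionality_dep => B;
  apply/funext => f; apply/propext; exact: RR'.
by case: _ / e in Rs' *; congr SubPresheaf; exact: Prop_irrelevance.
Qed.

Lemma sieve_pullM (A B C : tate) (f : chom A B) (g : chom B C) (R : sieve A) :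
  sieve_pull g (sieve_pull f R) = sieve_pull (hcomp g f) R.
Proof. by apply: sieve_ext => D h /=; rewrite hcompA. Qed.

Lemma sieve_pull1 (A : tate) (R : sieve A) : sieve_pull (hid A) R = R.
Proof. by apply: sieve_ext => D h /=; rewrite hcompf1. Qed.

Lemma sheaf_for_inj (F : presheaf) (A : tate) (R : sieve A) (y z : F A) :
  sheaf_for F R ->
  (forall (B : tate) (f : chom A B), R B f -> ps_map f y = ps_map f z) -> y = z.
Proof.
move=> FR yz.
have [|w [_ wu]] := FR (fun B f _ => ps_map f y).
  by move=> B C f g r r'; rewrite ps_mapM.
by rewrite -(wu y) // -(wu z) // => B f r; rewrite yz.
Qed.

Lemma matching_eq (F : presheaf) (A B : tate) (R : sieve A)
    (x : forall (B : tate) (f : chom A B), R B f -> F B) (f g : chom A B)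
    (r : R B f) (r' : R B g) : f = g -> x B f r = x B g r'.
Proof. by move=> e; case: _ / e in r' *; rewrite (Prop_irrelevance r r'). Qed.

Lemma univ_effective_epi_max (A : tate) : univ_effective_epi (sieve_max A).
Proof.
move=> B f C x xm; exists (x B (hid B) I); split=> [D g r|y yx].
  by rewrite (xm _ _ _ _ _ r); exact: (matching_eq (R := sieve_pull f (sieve_max A))) (hcompf1 g).
by rewrite -(yx B (hid B) I) ps_map1.
Qed.

Lemma univ_effective_epi_pull (A B : tate) (f : chom A B) (R : sieve A) :
  univ_effective_epi R -> univ_effective_epi (sieve_pull f R).
Proof. by move=> RE C g D; rewrite sieve_pullM. Qed.

Lemma univ_effective_epi_sheaf (A C : tate) (R : sieve A) :
  univ_effective_epi R -> sheaf_for (Spec C) R.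
Proof. by move=> /(_ A (hid A) C); rewrite sieve_pull1. Qed.

Lemma univ_effective_epi_trans (A : tate) (R R' : sieve A) :
  univ_effective_epi R ->
  (forall (B : tate) (f : chom A B), R B f -> univ_effective_epi (sieve_pull f R')) ->
  univ_effective_epi R'.
Proof.
move=> RE R'E A' p C.
have {RE} RE := univ_effective_epi_pull (f := p) RE.
have {R'E} R'E (B : tate) (f : chom A' B) : sieve_pull p R B f ->
    univ_effective_epi (sieve_pull f (sieve_pull p R')).
  by rewrite sieve_pullM; exact: R'E.
move: (sieve_pull p R) (sieve_pull p R') RE R'E => {}R {}R' RE R'E {p}.
move=> x xm.
have ex (B : tate) (f : chom A' B) (r : R B f) : {y : chom C B |
    forall (D : tate) (g : chom B D) (r' : R' D (hcomp g f)),
      hcomp g y = x D (hcomp g f) r'}.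
  apply: cid.
  have [|y [yP _]] := univ_effective_epi_sheaf (C := C) (R'E _ _ r)
      (x := fun D g r' => x D (hcomp g f) r').
    move=> D E g h r1 r2.
    have r3 : R' E (hcomp h (hcomp g f)) :=
      @sp_stable _ R' _ _ h (hcomp g f) r1.
    by rewrite (xm _ _ _ _ _ r3); apply: (@matching_eq _ _ _ R' x); rewrite hcompA.
  by exists y.
have [|z [zP zu]] := univ_effective_epi_sheaf (C := C) RE
    (x := fun B f r => sval (ex B f r)).
  move=> B D f g r r'; case: (ex _ _ r) (ex _ _ r') => [y yP] [y' y'P] /=.
  apply: (sheaf_for_inj (univ_effective_epi_sheaf (C := C) (R'E _ _ r'))).
  move=> E h r2; rewrite [RHS](y'P _ _ r2) /= hcompA.
  have r3 : R' E (hcomp (hcomp h g) f) by rewrite -hcompA.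
  by rewrite (yP _ _ r3); apply: (@matching_eq _ _ _ R' x); rewrite hcompA.
exists z; split=> [B h r'|z' z'P].
  have hR := univ_effective_epi_pull (f := h) RE.
  apply: (sheaf_for_inj (univ_effective_epi_sheaf (C := C) hR)) => D g r /=.
  have r2 : R' D (hcomp (hid D) (hcomp g h)).
    by rewrite hcomp1f; exact: (sp_stable g r').
  rewrite hcompA; have /= -> := zP _ _ r.
  case: (ex _ _ r) => y /= /(_ _ _ r2); rewrite hcomp1f => ->.
  have r3 : R' D (hcomp g h) := @sp_stable _ R' _ _ g h r'.
  have /= -> := xm _ _ _ _ r' r3.
  by apply: (@matching_eq _ _ _ R' x); rewrite hcomp1f.
apply: zu => B f r; case: (ex _ _ r) => y yP /=.
apply: (sheaf_for_inj (univ_effective_epi_sheaf (C := C) (R'E _ _ r))).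
by move=> D g r' /=; rewrite hcompA (yP _ _ r'); exact: z'P.
Qed.

Lemma covering_effective (A : tate) (R : sieve A) :
  covering R -> univ_effective_epi R.
Proof.
elim=> [//|B|B C f S _|B S S' _ SE _ S'E].
- exact: univ_effective_epi_max.
- exact: univ_effective_epi_pull.
- exact: univ_effective_epi_trans SE S'E.
Qed.

Lemma Spec_sheaf (A : tate) : is_sheaf (Spec A).
Proof. by move=> B R /covering_effective; exact: univ_effective_epi_sheaf. Qed.

Lemma sval_inj (T : Type) (P : T -> Prop) (x y : {z | P z}) :
  sval x = sval y -> x = y.
Proof. by case: x y => [x px] [y py] /=; exact: eq_exist. Qed.

Lemma Spec_image_sheaf (A B : tate) (f : chom A B) :
  open_immersion f -> is_sheaf (presheaf_of (Spec_image f)).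
Proof.
move=> /open_immersion_epi fE C R cR x xm.
have ex (D : tate) (g : chom C D) (r : R D g) :
    {h : chom B D | hcomp h f = sval (x D g r)}.
  by apply: cid; case: (x D g r) => k [[] [h hk]]; exists h.
have [|z [zP zu]] := Spec_sheaf cR (A := B) (x := fun D g r => sval (ex D g r)).
  move=> D E g h r r'; apply: fE.
  by rewrite /= -hcompA (svalP (ex D g r)) (svalP (ex E _ r')) -(xm _ _ _ _ r).
have zf : Spec_image f C (hcomp z f) by exists tt, z.
exists (exist _ (hcomp z f) zf); split=> [D g r|[k [[] [z' z'k]]] kP].
  apply: sval_inj; rewrite /= hcompA -(svalP (ex D g r)).
  by have /= -> := zP _ _ r.
apply: eq_exist; rewrite -z'k; congr hcomp; apply: zu => D g r.
apply: fE; rewrite (svalP (ex D g r)) -(kP D g r) /= -z'k.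
by rewrite hcompA.
Qed.

Lemma Spec_image_union (A B : tate) (f : chom A B) : open_immersion f ->
  exists2 F : forall B : tate, chom A B -> Prop,
    (forall (C : tate) (g : chom A C), F C g -> open_immersion g) &
    is_union F (Spec_image f).
Proof.
move=> fO; exists (fun C g => open_immersion g /\ subp_le (Spec_image g) (Spec_image f)).
  by move=> C g [].
by split=> [|C g []|V _] //; [exact: Spec_image_sheaf | apply; split].
Qed.

Definition Spec_open (A B : tate) (f : chom A B) (fO : open_immersion f) :
    open_subobject A :=
  @OpenSubobject A (Spec_image f) (Spec_image_union fO).

Lemma cellular_open (A B : tate) (f : chom A B) (s : A) :
  is_cellular_loc f s -> open_immersion f.
Proof.
by move=> fs; rewrite -(hcomp1f f); apply: oimm_step fs _; exact: oimm_id.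
Qed.

(* Main.v *)
Require Import Defs.
From HB Require Import structures.
From mathcomp Require Import all_boot all_algebra.
From mathcomp Require Import boolp classical_sets.
Set Implicit Arguments.
Unset Strict Implicit.
Unset Printing Implicit Defensive.
Local Obligation Tactic := idtac.
Import GRing.Theory.
Local Open Scope quotient_scope.
Local Open Scope classical_set_scope.
Local Open Scope ring_scope.

(** A cellular localisation at s is the quotient of A by s = 1: as s <= 1, an
    inverse of s that is <= 1 forces s = 1 ([bounded_inverse1]).  Hence
    Spec A{-s} consists of the g : A -> C with g(s) = 1 ([cellular_factor]).
    Write s_1, ..., s_k for the given elements and s for their supremum.  If
    g(s_i) = 1 then s_i <= s <= 1 gives g(s) = 1, so each Spec A{-s_i} lies in
    Spec A{-s}.

    For the converse, replace A by A{-s}, where the s_i have supremum 1, and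
    show that the family A -> A{-s_i} is a covering.  This is a statement about
    every base change A -> B, hence about any B with contracting elements s_i of
    supremum 1.  The quotient B/(s_i = 1) is explicit: in it x <= y means that
    s_i^n x <= y in B for some n ([cell_homP]).  It is again a Tate semiring
    ([cell_tate]), so it can be used to test the sheaf condition.
    Everything then rests on one algebraic fact, the analogue of
    a partition of unity: if I is an ideal and for every i some s_i^n x lies
    in I, then x is in I ([saturation_cover]), because every monomial of high
    degree in the s_i contains a high power of one of them.
    - With I = {z | z <= y} it says that B embeds in the product of the
      quotients ([cell_joint_inj]).
    - Elements y_i that agree on the overlaps B/(s_i = s_j = 1) =
      B/(s_i s_j = 1) glue to the supremum of the s_i^N y_i for N large
      ([cell_glue]).
    - With I open it says that I is the intersection of the preimages of its
      images in the quotients, so a homomorphism into B is continuous as soon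
      as its components are.
    Therefore morphisms from any C glue uniquely ([cell_cover_sheaf]).

    Finally, an open subobject W of Spec A containing all Spec A{-s_i} is a
    sheaf, and the structure map A -> A{-s} lies in W locally on that covering,
    hence lies in W.  So Spec A{-s} is the join of the Spec A{-s_i}, and
    completely prime filters turn this join into a union of sets of points. *)

(** * The order of an idempotent semiring *)

Section Order.
Variable A : topSemiRing.
Implicit Types x y z s : A.

Lemma tle_refl x : x <=o x.
Proof. exact: (topB_idem (ts_topB A)). Qed.

Lemma tle_trans x y z : x <=o y -> y <=o z -> x <=o z.
Proof. by rewrite /tle => xy <-; rewrite addrA xy. Qed.

Lemma tle_anti x y : x <=o y -> y <=o x -> x = y.
Proof. by move=> xy yx; rewrite -[RHS]xy addrC yx. Qed.

Lemma tle_addl x y : x <=o x + y.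
Proof. by rewrite /tle addrA tle_refl. Qed.

Lemma tle_add x y z : x <=o z -> y <=o z -> x + y <=o z.
Proof. by rewrite /tle => xz yz; rewrite -addrA yz. Qed.

Lemma tle_sum k (S : 'I_k -> A) (x : A) :
  (forall i, S i <=o x) -> \sum_i S i <=o x.
Proof.
move=> Sx; elim/big_ind: _ => [|y z|//]; last exact: tle_add.
by rewrite /tle add0r.
Qed.

Lemma tle_sum_term k (S : 'I_k -> A) i : S i <=o \sum_j S j.
Proof. by rewrite (bigD1 i) //=; exact: tle_addl. Qed.

Lemma tle_mul2l z x y : x <=o y -> z * x <=o z * y.
Proof. by rewrite /tle -mulrDr => ->. Qed.

Lemma tle_mul2r z x y : x <=o y -> x * z <=o y * z.
Proof. by rewrite /tle -mulrDl => ->. Qed.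

Lemma tle_mull s x : s <=o 1 -> s * x <=o x.
Proof. by move=> /(tle_mul2r x); rewrite mul1r. Qed.

Lemma tle_exp s n : s <=o 1 -> s ^+ n <=o 1.
Proof.
move=> s1; elim: n => [|n IH]; first exact: tle_refl.
by rewrite exprS; apply: tle_trans (tle_mull _ s1) IH.
Qed.

Lemma down_ideal y : ideal [set x | x <=o y].
Proof.
split=> /= [|x z|x z xz /(tle_trans xz)//]; last exact: tle_add.
by rewrite /tle add0r.
Qed.

End Order.

Lemma tle_hom (A B : topSemiRing) (f : chom A B) (x y : A) :
  x <=o y -> f x <=o f y.
Proof. by have [_ fD] := hom_add f; rewrite /tle -fD => ->. Qed.

Lemma chom_eq (A B : topSemiRing) (f g : chom A B) : f = g -> f =1 g.
Proof. by move=> ->. Qed.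

Lemma hom_sum (A B : topSemiRing) (f : chom A B) k (S : 'I_k -> A) :
  f (\sum_i S i) = \sum_i f (S i).
Proof. by have [f0 fD] := hom_add f; exact: (big_morph f fD f0). Qed.

Lemma hom_exp (A B : topSemiRing) (f : chom A B) (x : A) n :
  f (x ^+ n) = f x ^+ n.
Proof.
have [f1 fM] := hom_mul f.
by elim: n => [|n IH]; rewrite ?expr0 // !exprS fM IH.
Qed.

(** * Ideals and saturation *)

Lemma preimage_ideal (M N : nmodType) (f : M -> N) (I : set N) :
  nmod_morphism f -> ideal I -> ideal (f @^-1` I).
Proof.
move=> [f0 fD] [I0 ID Ile]; split=> /= [|x y|x y xy].
- by rewrite f0.
- by rewrite fD; exact: ID.
- by apply: Ile; rewrite /tle -fD xy.
Qed.

Lemma ideal_sum_ideal (A : comPzSemiRingType) (I J : set A) :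
  ideal (ideal_sum I J).
Proof.
split=> [K [] //|x y Ix Iy K idK IJ|x y xy Iy K idK IJ].
  by have [_ KD _] := idK; apply: KD; [exact: Ix | exact: Iy].
by have [_ _ Kle] := idK; apply: Kle xy _; exact: Iy.
Qed.

Lemma ideal_sum_preimage (A B : topSemiRing) (f : chom A B) (I J : set B) :
  ideal_sum (f @^-1` I) (f @^-1` J) `<=` f @^-1` ideal_sum I J.
Proof.
move=> z; apply=> [|x y Ix Jy].
  exact: preimage_ideal (hom_add f) (ideal_sum_ideal I J).
by have [_ fM] := hom_mul f; rewrite /= fM => K idK; apply.
Qed.

Section Saturation.
Variable A : topSemiRing.
Implicit Types (x y s t : A) (I : set A).

(** For s contracting and I an ideal, the preimage in A of the image of I in
    A/(s = 1). *)
Definition saturation s I : set A := [set x | exists n, I (s ^+ n * x)].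

Lemma saturation_sub s I : I `<=` saturation s I.
Proof. by move=> x Ix; exists 0; rewrite expr0 mul1r. Qed.

Lemma saturation1 I x : saturation 1 I x -> I x.
Proof. by case=> n; rewrite expr1n mul1r. Qed.

Lemma saturation_leq s I x n m : s <=o 1 -> ideal I -> (n <= m)%N ->
  I (s ^+ n * x) -> I (s ^+ m * x).
Proof.
move=> s1 [_ _ Ile] nm; apply: Ile.
by rewrite -(subnK nm) exprD -mulrA; apply: tle_mull; exact: tle_exp.
Qed.

Lemma saturation_ideal s I : s <=o 1 -> ideal I -> ideal (saturation s I).
Proof.
move=> s1 idI; have [I0 ID Ile] := idI; split.
- exact: saturation_sub.
- move=> x y [n In] [m Im]; exists (n + m)%N; rewrite mulrDr; apply: ID.
    by apply: saturation_leq In => //; exact: leq_addr.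
  by apply: saturation_leq Im => //; exact: leq_addl.
- by move=> x y xy [n In]; exists n; apply: Ile In; exact: tle_mul2l.
Qed.

(** Expanding (s + t)^(n + m), every monomial is divisible by s^n or by t^m; the
    induction peels off one factor s + t and moves s or t into x. *)
Lemma saturationD s t I x : s <=o 1 -> t <=o 1 -> ideal I ->
  saturation s I x -> saturation t I x -> saturation (s + t) I x.
Proof.
move=> s1 t1 idI [n In] [m Im]; have [_ ID Ile] := idI.
exists (n + m)%N; have [N] := ubnP (n + m)%N.
elim: N => // N IH in n m x In Im *; rewrite ltnS => leN.
have st1 : s + t <=o 1 by exact: tle_add.
case: n => [|n] in In leN *.
  by apply: Ile In; rewrite expr0 mul1r; apply: tle_mull; exact: tle_exp.
case: m => [|m] in Im leN *.
  by apply: Ile Im; rewrite expr0 mul1r; apply: tle_mull; exact: tle_exp.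
(* Splitting the last factor, s x needs one power of s less, and t x one power
   of t less. *)
rewrite addSn exprSr -mulrA mulrDl mulrDr; apply: ID.
- apply: IH => //; first by rewrite mulrA -exprSr.
  by apply: Ile Im; apply: tle_mul2l; exact: tle_mull.
- rewrite addnS -addSn; apply: IH; last by rewrite addSn -addnS.
    by apply: Ile In; apply: tle_mul2l; exact: tle_mull.
  by rewrite mulrA -exprSr.
Qed.

Lemma saturation_sum k (S : 'I_k -> A) I x : (forall i, S i <=o 1) ->
  ideal I -> (forall i, saturation (S i) I x) -> saturation (\sum_i S i) I x.
Proof.
move=> S1 idI Sx; suff [] : \sum_i S i <=o 1 /\ saturation (\sum_i S i) I x by [].
elim/big_ind: _ => [|s t [s1 sx] [t1 tx]|i _]; last by split.
  split; first by rewrite /tle add0r.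
  by exists 1; rewrite expr1 mul0r; case: idI.
by split; [exact: tle_add | exact: saturationD].
Qed.

End Saturation.

(** * Quotients by a congruence *)

Record congruence (A : comPzSemiRingType) := Congruence {
  cg_rel :> A -> A -> Prop;
  cg_refl : forall x, cg_rel x x;
  cg_sym : forall x y, cg_rel x y -> cg_rel y x;
  cg_trans : forall x y z, cg_rel x y -> cg_rel y z -> cg_rel x z;
  cg_add : forall x x' y y', cg_rel x x' -> cg_rel y y' -> cg_rel (x + y) (x' + y');
  cg_mul : forall x x' y y', cg_rel x x' -> cg_rel y y' -> cg_rel (x * y) (x' * y') }.

Section Quotient.
Variables (A : comPzSemiRingType) (E : congruence A).

Definition cg_bool : rel A := fun x y => `[< E x y >].

Lemma cg_bool_refl : reflexive cg_bool.
Proof. by move=> x; apply/asboolP; exact: cg_refl. Qed.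

Lemma cg_bool_sym : symmetric cg_bool.
Proof. by move=> x y; apply/asboolP/asboolP; exact: cg_sym. Qed.

Lemma cg_bool_trans : transitive cg_bool.
Proof.
by move=> y x z /asboolP xy /asboolP yz; apply/asboolP; exact: cg_trans xy yz.
Qed.

Canonical cg_equiv := EquivRel cg_bool cg_bool_refl cg_bool_sym cg_bool_trans.

Definition quot := {eq_quot cg_equiv}.
HB.instance Definition _ := Choice.on quot.
HB.instance Definition _ := EqQuotient.on quot.

Definition cls (x : A) : quot := \pi_quot x.

Lemma clsP x y : cls x = cls y <-> E x y.
Proof.
split=> [/eqmodP /asboolP //|xy]; by apply/eqmodP/asboolP.
Qed.

Lemma cls_surj (q : quot) : exists x, q = cls x.
Proof. by exists (repr q); rewrite /cls reprK. Qed.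

Lemma cls_repr x : E (repr (cls x)) x.
Proof. by apply/clsP; rewrite /cls reprK. Qed.

Definition quot_add (p q : quot) := cls (repr p + repr q).
Definition quot_mul (p q : quot) := cls (repr p * repr q).

Lemma quot_addE x y : quot_add (cls x) (cls y) = cls (x + y).
Proof. by apply/clsP/cg_add; exact: cls_repr. Qed.

Lemma quot_mulE x y : quot_mul (cls x) (cls y) = cls (x * y).
Proof. by apply/clsP/cg_mul; exact: cls_repr. Qed.

Lemma quot_addA : associative quot_add.
Proof.
move=> p q r; have [x ->] := cls_surj p; have [y ->] := cls_surj q.
by have [z ->] := cls_surj r; rewrite !quot_addE addrA.
Qed.

Lemma quot_addC : commutative quot_add.
Proof. by move=> p q; rewrite /quot_add addrC. Qed.

Lemma quot_add0 : left_id (cls 0) quot_add.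
Proof. by move=> p; have [x ->] := cls_surj p; rewrite quot_addE add0r. Qed.

HB.instance Definition _ := GRing.isNmodule.Build quot quot_addA quot_addC quot_add0.

Lemma quot_mulA : associative quot_mul.
Proof.
move=> p q r; have [x ->] := cls_surj p; have [y ->] := cls_surj q.
by have [z ->] := cls_surj r; rewrite !quot_mulE mulrA.
Qed.

Lemma quot_mulC : commutative quot_mul.
Proof. by move=> p q; rewrite /quot_mul mulrC. Qed.

Lemma quot_mul1 : left_id (cls 1) quot_mul.
Proof. by move=> p; have [x ->] := cls_surj p; rewrite quot_mulE mul1r. Qed.

Lemma quot_mulDl : left_distributive quot_mul quot_add.
Proof.
move=> p q r; have [x ->] := cls_surj p; have [y ->] := cls_surj q.
by have [z ->] := cls_surj r; rewrite !(quot_addE, quot_mulE) mulrDl.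
Qed.

Lemma quot_mul0 : left_zero (cls 0) quot_mul.
Proof. by move=> p; have [x ->] := cls_surj p; rewrite quot_mulE mul0r. Qed.

HB.instance Definition _ := GRing.Nmodule_isComPzSemiRing.Build quot
  quot_mulA quot_mulC quot_mul1 quot_mulDl quot_mul0.

Lemma clsD x y : cls (x + y) = cls x + cls y.
Proof. by rewrite -quot_addE. Qed.

Lemma clsM x y : cls (x * y) = cls x * cls y.
Proof. by rewrite -quot_mulE. Qed.

End Quotient.

(** * The quotient topology *)

Section TopQuotient.
Variables (A : topSemiRing) (E : congruence A).

Definition quot_open : set (set (quot E)) :=
  [set J | ideal J /\ ts_open (cls E @^-1` J)].

Lemma cls_add : nmod_morphism (cls E).
Proof. by split=> //; exact: clsD. Qed.

Lemma quot_topB : is_topBmod quot_open.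
Proof.
have topA := ts_topB A; split.
- by move=> q; have [x ->] := cls_surj q; rewrite -clsD (topB_idem topA).
- by move=> I [].
- exists setT; split=> //; have [I OI] := topB_nonempty topA.
  exact: topB_enlarge OI _ _.
- move=> I J [_ OI] idJ IJ; split=> //; apply: (topB_enlarge topA OI).
    exact: preimage_ideal cls_add idJ.
  by move=> x; exact: IJ.
- move=> I J [[I0 ID Ile] OI] [[J0 JD Jle] OJ]; split.
    split=> //= [x y [Ix Jx] [Iy Jy]|x y xy [Iy Jy]].
      by split; [exact: ID | exact: JD].
    by split; [exact: Ile xy Iy | exact: Jle xy Jy].
  exact: topB_inter topA _ _ OI OJ.
Qed.

Lemma quot_transl (p : quot E) :
  continuous_for quot_open quot_open (fun q => p * q).
Proof.
have [x ->] := cls_surj p; move=> J [idJ OJ]; split.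
  apply: preimage_ideal idJ; split=> [|y z]; first by rewrite mulr0.
  by rewrite mulrDr.
rewrite (_ : _ @^-1` _ = (fun y => x * y) @^-1` (cls E @^-1` J)); first exact: ts_transl.
by apply/funext => y /=; rewrite clsM.
Qed.

Definition quotT : topSemiRing := @TopSemiRing (quot E) _ quot_topB quot_transl.

Lemma cls_cont : continuous_for (@ts_open A) (@ts_open quotT) (cls E).
Proof. by move=> I []. Qed.

Lemma cls_mul : monoid_morphism (cls E).
Proof. by split=> //; exact: clsM. Qed.

Definition quot_hom : chom A quotT := @CHom A quotT (cls E) cls_add cls_mul cls_cont.

Lemma quot_lift (C : topSemiRing) (g : chom A C) :
  (forall x y, E x y -> g x = g y) -> exists h : chom quotT C, hcomp h quot_hom = g.
Proof.
move=> gE; pose h (q : quotT) := g (repr (q : quot E)).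
have hE x : h (cls E x) = g x by apply: gE; exact: cls_repr.
have [g0 gD] := hom_add g; have [g1 gM] := hom_mul g.
have h_add : nmod_morphism h.
  split=> [|p q]; first by rewrite hE.
  have [x ->] := cls_surj p; have [y ->] := cls_surj q.
  by rewrite -clsD !hE gD.
have h_mul : monoid_morphism h.
  split=> [|p q]; first by rewrite hE.
  have [x ->] := cls_surj p; have [y ->] := cls_surj q.
  by rewrite -clsM !hE gM.
have h_cont : continuous_for (@ts_open quotT) (@ts_open C) h.
  move=> I OI; split; first exact: preimage_ideal h_add (topB_ideal (ts_topB C) OI).
  rewrite (_ : _ @^-1` _ = g @^-1` I); first exact: hom_cont.
  by apply/funext => x /=; rewrite hE.
by exists (CHom h_add h_mul h_cont); apply: hom_ext => x /=; exact: hE.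
Qed.

Lemma quot_adic : adic A -> adic quotT.
Proof.
move=> adA I J [_ OI] [_ OJ]; split; first exact: ideal_sum_ideal.
apply: (topB_enlarge (ts_topB A) (adA _ _ OI OJ)).
  exact: preimage_ideal cls_add (ideal_sum_ideal I J).
exact: (ideal_sum_preimage (f := quot_hom)).
Qed.

End TopQuotient.

(** * Contracting parts *)

Section CircHom.
Variables (A B : topSemiRing) (f : chom A B).

Lemma circ_map_subproof (x : circ A) : f (val x) \in contracting B.
Proof.
have [f1 _] := hom_mul f.
by apply/contractingP; rewrite -f1; apply: tle_hom; apply/contractingP; exact: (valP x).
Qed.

Definition circ_map (x : circ A) : circ B := exist _ (f (val x)) (circ_map_subproof x).

Lemma circ_map_add : nmod_morphism circ_map.
Proof.
by have [f0 fD] := hom_add f; split=> [|x y]; apply: val_inj => /=; rewrite ?f0 ?fD.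
Qed.

Lemma circ_map_mul : monoid_morphism circ_map.
Proof.
by have [f1 fM] := hom_mul f; split=> [|x y]; apply: val_inj => /=; rewrite ?f1 ?fM.
Qed.

Lemma circ_map_cont : continuous_for (@ts_open (circ A)) (@ts_open (circ B)) circ_map.
Proof.
move=> J [idJ [I OI IJ]]; split; first exact: preimage_ideal circ_map_add idJ.
by exists (f @^-1` I); [exact: hom_cont | move=> x Ix; exact: IJ].
Qed.

Definition circ_hom : chom (circ A) (circ B) :=
  CHom circ_map_add circ_map_mul circ_map_cont.

End CircHom.

(** * The cellular quotient A/(s = 1) *)

Section Cell.
Variables (A : topSemiRing) (s : A) (s1 : s <=o 1).

Definition cell_le (x y : A) : Prop := saturation s [set z | z <=o y] x.

Lemma cell_le_refl x : cell_le x x.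
Proof. by apply: saturation_sub; exact: tle_refl. Qed.

Lemma saturation_cell_le I x y : ideal I -> cell_le x y ->
  saturation s I y -> saturation s I x.
Proof.
move=> [_ _ Ile] [n xy] [m Iy]; exists (m + n)%N; apply: Ile Iy.
by rewrite exprD -mulrA; exact: tle_mul2l.
Qed.

Lemma cell_le_trans x y z : cell_le x y -> cell_le y z -> cell_le x z.
Proof. exact: (saturation_cell_le (down_ideal z)). Qed.

Lemma cell_le_le x y z : cell_le x y -> y <=o z -> cell_le x z.
Proof. by move=> xy yz; apply: cell_le_trans xy _; exact: saturation_sub. Qed.

Lemma cell_le_add x x' y y' : cell_le x x' -> cell_le y y' ->
  cell_le (x + y) (x' + y').
Proof.
have [_ D _] := saturation_ideal s1 (down_ideal (x' + y')).
move=> xx yy; apply: D; [apply: cell_le_le xx _ | apply: cell_le_le yy _].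
  exact: tle_addl.
by rewrite addrC; exact: tle_addl.
Qed.

Lemma cell_le_mul x x' y y' : cell_le x x' -> cell_le y y' ->
  cell_le (x * y) (x' * y').
Proof.
move=> [n xx] [m yy]; exists (n + m)%N; rewrite /= exprD mulrACA.
by apply: tle_trans (tle_mul2r _ xx) _; exact: tle_mul2l.
Qed.

Program Definition cell_cong : congruence A :=
  @Congruence A (fun x y => cell_le x y /\ cell_le y x) _ _ _ _ _.
Next Obligation. by move=> x; split; exact: cell_le_refl. Qed.
Next Obligation. by move=> x y []. Qed.
Next Obligation.
by move=> x y z [xy yx] [yz zy]; split; [exact: cell_le_trans xy yz | exact: cell_le_trans zy yx].
Qed.
Next Obligation. by move=> x x1 y y1 [] ? ? [] ? ?; split; apply: cell_le_add. Qed.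
Next Obligation. by move=> x x1 y y1 [] ? ? [] ? ?; split; apply: cell_le_mul. Qed.

Definition cell : topSemiRing := quotT cell_cong.
Definition cell_hom : chom A cell := quot_hom cell_cong.

Lemma cell_surj (q : cell) : exists x, cell_hom x = q.
Proof. by have [x ->] := cls_surj (q : quot cell_cong); exists x. Qed.

(** The order of a quotient is x + y ~ y; here it reduces to the preorder that
    defines the congruence, since x <= x + y. *)
Lemma cell_homP x y : cell_hom x <=o cell_hom y <-> cell_le x y.
Proof.
have [_ D] := hom_add cell_hom; rewrite /tle -D.
have xy : x <=o x + y by exact: tle_addl.
split=> [/(clsP cell_cong) [h _]|h].
  by apply: cell_le_trans h; apply: saturation_sub.
apply/(clsP cell_cong); split; last first.
  by apply: saturation_sub; rewrite /= addrC; exact: tle_addl.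
rewrite -{2}(tle_refl y); apply: cell_le_add h _; exact: cell_le_refl.
Qed.

Lemma cell_hom_s : cell_hom s = 1.
Proof.
apply/(clsP cell_cong); split; first exact: saturation_sub.
by exists 1; rewrite /= mulr1; exact: tle_refl.
Qed.

Lemma cell_hom_exp n x : cell_hom (s ^+ n * x) = cell_hom x.
Proof.
by have [_ M] := hom_mul cell_hom; rewrite M hom_exp cell_hom_s expr1n mul1r.
Qed.

Lemma cell_lift (C : topSemiRing) (g : chom A C) :
  g s = 1 -> exists h : chom cell C, hcomp h cell_hom = g.
Proof.
move=> gs; have le x y : cell_le x y -> g x <=o g y.
  move=> [n /(tle_hom g)]; have [_ gM] := hom_mul g.
  by rewrite gM hom_exp gs expr1n mul1r.
by apply: quot_lift => x y [/le xy /le]; exact: tle_anti.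
Qed.

(** The ideal generated by the image of I: as the order of the quotient only
    sees elements up to powers of s, the image has to be taken after
    saturating. *)
Definition cell_image (I : set A) : set cell := cell_hom @` saturation s I.

Lemma cell_imageP I x : ideal I -> cell_image I (cell_hom x) <-> saturation s I x.
Proof.
move=> idI; split=> [[y Iy /(clsP cell_cong) [_ xy]]|Ix]; last by exists x.
exact: saturation_cell_le xy Iy.
Qed.

Lemma cell_image_open I : ts_open I -> ts_open (cell_image I).
Proof.
move=> OI; have idI := topB_ideal (ts_topB A) OI.
have [J0 JD Jle] := saturation_ideal s1 idI.
have id : ideal (cell_image I).
  split; first by exists 0.
    move=> p q [x Ix <-] [y Iy <-]; exists (x + y); first exact: JD.
    by have [_ D] := hom_add cell_hom.
  move=> p q pq [y Iy yq]; move: pq; rewrite -yq.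
  have [x <-] := cell_surj p => /cell_homP xy.
  exact/(cell_imageP _ idI)/(saturation_cell_le idI xy).
split=> //; apply: (topB_enlarge (ts_topB A) OI).
  exact: preimage_ideal (cls_add cell_cong) id.
by move=> x Ix; exists x => //; exact: saturation_sub.
Qed.

(** A class <= 1 has a representative <= 1 lying in I: multiplying any
    representative by a power of s does not change its class, and a high power
    achieves both conditions. *)
Lemma circ_cell_lift (I : set A) (q : circ cell) :
  ideal I -> cell_image I (val q) ->
  exists2 y : circ A, circ_hom cell_hom y = q & I (val y).
Proof.
move=> idI [x [n Ix] xq].
have [m x1] : cell_le x 1.
  apply/cell_homP; rewrite xq; have [-> _] := hom_mul cell_hom.
  exact/contractingP/(valP q).
have y1 : s ^+ (n + m) * x \in contracting A.
  by apply/contractingP; exact: saturation_leq (down_ideal 1) (leq_addl _ _) x1.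
exists (exist (fun z : A => z \in contracting A) _ y1); last exact: saturation_leq idI (leq_addr _ _) Ix.
by apply: val_inj; rewrite -xq; exact: cell_hom_exp.
Qed.

Lemma circ_cell_surj (q : circ cell) : exists y, circ_hom cell_hom y = q.
Proof.
have [x xq] := cell_surj (val q).
have [//||y] := @circ_cell_lift setT q; last by exists y.
by exists x => //; exists 0.
Qed.

(** Taking contracting parts commutes with the quotient, topology included:
    circ (A/(s = 1)) carries the quotient topology of circ A, so what has to be
    checked there can be pulled back to circ A. *)
Lemma circ_cell_open (J : set (circ cell)) : ideal J ->
  ts_open (circ_hom cell_hom @^-1` J) -> ts_open J.
Proof.
move=> idJ [_ [I OI IJ]]; split=> //; exists (cell_image I).
  exact: cell_image_open.
move=> q /(circ_cell_lift (topB_ideal (ts_topB A) OI)) [y <- Iy].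
exact: IJ.
Qed.

Lemma circ_cell_adic : adic (circ A) -> adic (circ cell).
Proof.
move=> adA I J OI OJ; apply: circ_cell_open; first exact: ideal_sum_ideal.
have OI' := @hom_cont _ _ (circ_hom cell_hom) _ OI.
have OJ' := @hom_cont _ _ (circ_hom cell_hom) _ OJ.
apply: (topB_enlarge (ts_topB (circ A)) (adA _ _ OI' OJ')).
  exact: preimage_ideal (hom_add _) (ideal_sum_ideal I J).
exact: ideal_sum_preimage.
Qed.

(** The localising family for the quotient is the image of the one for A.  A map
    g out of circ (A/(s = 1)) inverting this image extends to A by the universal
    property of A; the extension sends s, which is contracting, to
    g(1) = 1, so it descends to the quotient. *)
Lemma cell_tate : is_tate A -> is_tate cell.
Proof.
case=> adA adcA [S [[S1 SM] Sopen [Sinv Suniv]]].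
have [p1 pM] := hom_mul (circ_hom cell_hom).
split; [exact: quot_adic|exact: circ_cell_adic|].
exists (circ_hom cell_hom @` S); split.
- split; first by exists 1.
  by move=> _ _ [x Sx <-] [y Sy <-]; exists (x * y); [exact: SM | exact: pM].
- move=> _ [t St <-]; apply: circ_cell_open.
    exact: (@down_ideal (circ cell)).
  apply: (topB_enlarge (ts_topB (circ A)) (Sopen _ St)).
    exact: preimage_ideal (hom_add _) (@down_ideal (circ cell) _).
  by move=> x; exact: (@tle_hom _ _ (circ_hom cell_hom)).
- split=> [_ [t St <-]|C g ginv].
    have [y ty] := Sinv _ St; exists (cell_hom y).
    have [h1 hM] := hom_mul cell_hom.
    by rewrite -h1 -ty; exact/esym/hM.
  have gpinv t : S t -> tinvertible (hcomp g (circ_hom cell_hom) t).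
    by move=> St; apply: ginv; exists t.
  have [h0 [h0g h0u]] := Suniv C _ gpinv.
  have h0E (x : circ A) : h0 (val x) = g (circ_hom cell_hom x).
    exact: chom_eq h0g x.
  have sc : s \in contracting A by exact/contractingP.
  have h0s : h0 s = 1.
    have [g1 _] := hom_mul g.
    rewrite (h0E (exist _ s sc)) -g1; congr (g _); apply: val_inj.
    exact: cell_hom_s.
  have [h hE] := cell_lift h0s.
  exists h; split=> [|h' h'g].
    apply: hom_ext => q; have [y <-] := circ_cell_surj q.
    by rewrite -h0E -hE.
  have h'E : hcomp h' cell_hom = h0.
    apply/esym/h0u/hom_ext => x /=.
    exact: chom_eq h'g (circ_hom cell_hom x).
  apply: hom_ext => q; have [x <-] := cell_surj q.
  exact: chom_eq (etrans hE (esym h'E)) x.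
Qed.

End Cell.

(** * Covers by cellular quotients *)

Lemma open_setT (A : topSemiRing) : ts_open [set: A].
Proof.
have [I OI] := topB_nonempty (ts_topB A).
exact: (topB_enlarge (ts_topB A) OI).
Qed.

Lemma open_bigI (A : topSemiRing) k (F : 'I_k -> set A) :
  (forall i, ts_open (F i)) -> ts_open (\big[setI/setT]_i F i).
Proof.
move=> OF; elim/big_ind: _ => // [|I J]; first exact: open_setT.
exact: topB_inter (ts_topB A) I J.
Qed.

Section Cover.
Variables (B : tate) (k : nat) (s : 'I_k -> B).
Hypotheses (s1 : forall i, s i <=o 1) (sum1 : \sum_i s i = 1).

(** The partition of unity argument: a local membership statement for an ideal
    is a global one, since 1 is the supremum of the s i. *)
Lemma saturation_cover (I : set B) x : ideal I ->
  (forall i, saturation (s i) I x) -> I x.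
Proof.
by move=> idI /(saturation_sum s1 idI); rewrite sum1; exact: saturation1.
Qed.

Let Q i : tate := Tate (cell_tate (s1 i) (tate_ax B)).
Let p i : chom B (Q i) := cell_hom (s1 i).

Lemma cell_joint_inj x y : (forall i, p i x = p i y) -> x = y.
Proof.
move=> xy; suff le u v : (forall i, p i u = p i v) -> u <=o v.
  by apply: tle_anti; apply: le => // i; rewrite xy.
move=> uv; apply: saturation_cover (down_ideal v) _ => i.
by apply/(cell_homP (s1 i)); rewrite -/(p i) uv; exact: tle_refl.
Qed.

(** On the j-th quotient, the term of index j of the glued element is y j, and the
    others are below it by the compatibility hypothesis, which supplies the
    factor (s j)^N that is invisible in that quotient. *)
Lemma cell_glue (y : 'I_k -> B) :
  (forall i j, saturation (s i * s j) [set z | z <=o y j] (y i)) ->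
  exists x, forall i, p i x = p i (y i).
Proof.
move=> yy.
pose n (ij : 'I_k * 'I_k) := sval (cid (yy ij.1 ij.2)).
have nP ij : (s ij.1 * s ij.2) ^+ n ij * y ij.1 <=o y ij.2 := svalP (cid (yy ij.1 ij.2)).
pose N := \max_ij n ij.
have NP i j : (s i * s j) ^+ N * y i <=o y j.
  apply: saturation_leq (down_ideal (y j)) (leq_bigmax (i, j)) (nP (i, j)).
  by exact: tle_trans (tle_mull (s j) (s1 i)) (s1 j).
exists (\sum_i s i ^+ N * y i) => j; apply: tle_anti.
  rewrite hom_sum; apply: tle_sum => i; apply/(cell_homP (s1 j)).
  by exists N; rewrite /= mulrA -exprMn [s j * s i]mulrC; exact: NP.
rewrite -[p j (y j)](cell_hom_exp (s1 j) N).
exact: (tle_hom (p j) (tle_sum_term (fun i => s i ^+ N * y i) j)).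
Qed.

(** Only the values of a matching family on the quotients B/(s i = 1) matter, as
    every member of the sieve factors through one of them.  These values agree
    on B/(s i * s j = 1), where both s i and s j become 1, hence glue. *)
Lemma cell_cover_sheaf (C : tate) (R : sieve B) :
  (forall (D : tate) (g : chom B D), R D g <-> exists i, g (s i) = 1) ->
  sheaf_for (Spec C) R.
Proof.
move=> RP x xm.
have Rp i : R (Q i) (p i) by apply/RP; exists i; exact: cell_hom_s.
pose xi i : chom C (Q i) := x (Q i) (p i) (Rp i).
have xE (D : tate) (g : chom B D) (r : R D g) i (h : chom (Q i) D) :
    hcomp h (p i) = g -> x D g r = hcomp h (xi i).
  move=> hg; have r' : R D (hcomp h (p i)) by rewrite hg.
  by rewrite (@matching_eq _ _ _ R x _ _ r r' (esym hg)) -(xm _ _ _ _ (Rp i)).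
have ex c : {y : B | forall i, p i y = xi i c}.
  apply: cid.
  pose y i := sval (cid (cell_surj (xi i c))).
  have yP i : p i (y i) = xi i c := svalP (cid (cell_surj (xi i c))).
  have [i j|z zP] := cell_glue (y := y); last by exists z => i; rewrite zP yP.
  have sij : s i * s j <=o 1 by exact: tle_trans (tle_mull (s j) (s1 i)) (s1 j).
  pose D : tate := Tate (cell_tate sij (tate_ax B)).
  pose q : chom B D := cell_hom sij.
  have [q1 qM] := hom_mul q.
  have qi : q (s i) = 1 /\ q (s j) = 1.
    have le m : q (s m) <=o 1 by rewrite -q1; apply: tle_hom.
    have qij : q (s i) * q (s j) = 1 by rewrite -qM; exact: cell_hom_s.
    split; apply: tle_anti (le _) _; rewrite -qij; last exact: tle_mull.
    by rewrite mulrC; exact: tle_mull.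
  have [hi hiE] := cell_lift (s1 i) qi.1; have [hj hjE] := cell_lift (s1 j) qi.2.
  have rq : R D q by apply/RP; exists i; exact: qi.1.
  apply/(cell_homP sij).
  have qE : q (y i) = q (y j).
    rewrite -(chom_eq hiE (y i)) -(chom_eq hjE (y j)).
    rewrite -[LHS]/(hi (p i (y i))) -[RHS]/(hj (p j (y j))) !yP.
    exact: chom_eq (etrans (esym (xE D q rq i hi hiE)) (xE D q rq j hj hjE)) c.
  by rewrite -/q qE; exact: tle_refl.
pose g c := sval (ex c); have gP c i : p i (g c) = xi i c := svalP (ex c) i.
have g_add : nmod_morphism g.
  split=> [|c d]; apply: cell_joint_inj => i; have [p0 pD] := hom_add (p i);
    have [x0 xD] := hom_add (xi i); by rewrite ?pD !gP ?xD ?x0 ?p0.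
have g_mul : monoid_morphism g.
  split=> [|c d]; apply: cell_joint_inj => i; have [p0 pM] := hom_mul (p i);
    have [x0 xM] := hom_mul (xi i); by rewrite ?pM !gP ?xM ?x0 ?p0.
have g_cont : continuous_for (@ts_open C) (@ts_open B) g.
  move=> I OI; have idI := topB_ideal (ts_topB B) OI.
  (* The preimage of I under g contains, and in fact equals, the finite
     intersection of the preimages of the images of I in the quotients. *)
  pose F i := xi i @^-1` cell_image (s1 := s1 i) I.
  have OF : ts_open (\big[setI/setT]_i F i).
    by apply: open_bigI => i; apply: hom_cont; exact: cell_image_open.
  apply: (topB_enlarge (ts_topB C) OF); first exact: preimage_ideal g_add idI.
  move=> c cI; apply: saturation_cover => // i.
  apply/(cell_imageP (s1 i) _ idI); rewrite -/(p i) gP.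
  by move: cI; rewrite (bigD1 i) //= => -[].
exists (CHom g_add g_mul g_cont); split=> [D h r|h hP].
  have [i hi] := (RP _ _).1 r; have [h' h'E] := cell_lift (s1 i) hi.
  rewrite (xE _ _ r i h' h'E) -h'E; apply: hom_ext => c.
  by rewrite -[LHS]/(h' (p i (g c))) gP.
apply: hom_ext => c; apply: cell_joint_inj => i.
by rewrite -[LHS]/(p i (g c)) gP /xi -(hP _ _ (Rp i)).
Qed.

End Cover.

(** * Cellular localisations and the cover formula *)

(** If s x = 1 and x <= 1 then 1 = s x <= s. *)
Lemma bounded_inverse1 (A : topSemiRing) (s : A) :
  s <=o 1 -> bounded_inverse 1 s <-> s = 1.
Proof.
move=> s1; split=> [[x [t [sx t1 xt]]]|->]; last first.
  by exists 1, 1; rewrite mulr1; split=> //; exact: tle_refl.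
apply: tle_anti s1 _; rewrite mul1r in t1; rewrite -sx -[s in X in _ <=o X]mulr1 -t1.
exact: tle_mul2l.
Qed.

Lemma cellular_factor (A L : tate) (f : chom A L) (s : A) :
  is_cellular_loc f s ->
  forall (C : tate) (g : chom A C), (exists h, hcomp h f = g) <-> g s = 1.
Proof.
move=> fs C g; have s1 := bloc_contracting fs.
have le1 (D : tate) (h : chom A D) : h s <=o 1.
  by have [h1 _] := hom_mul h; rewrite -h1; exact: tle_hom.
have inv (D : tate) (h : chom A D) : bounded_inverse (h 1) (h s) <-> h s = 1.
  by have [-> _] := hom_mul h; exact: bounded_inverse1.
split=> [[h <-]|/inv /(bloc_univ fs) [h [hf _]]]; last by exists h.
have /inv /= -> := bloc_inv fs; by have [h1 _] := hom_mul h.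
Qed.

(** The given localisations of A are only known by their universal property; when
    one of them factors through an epimorphism f, it is also a localisation of
    the target of f. *)
Lemma cellular_base (A L M : tate) (f : chom A L) (u : chom L M) (s : A) :
  (forall (C : tate) (h k : chom L C), hcomp h f = hcomp k f -> h = k) ->
  is_cellular_loc (hcomp u f) s -> is_cellular_loc u (f s).
Proof.
move=> fE us; have [f1 _] := hom_mul f; split.
- by rewrite -f1; apply: tle_hom; exact: bloc_contracting us.
- by split; [exact: tle_refl | exists 1; rewrite mulr1].
- by have := bloc_inv us; rewrite /= f1.
- move=> C g gs; have gs' : bounded_inverse (hcomp g f 1) (hcomp g f s).
    by rewrite /= f1.
  have [h [hg hu]] := bloc_univ us gs'.
  exists h; split=> [|h' h'g]; first by apply: fE; rewrite -hcompA.
  by apply: hu; rewrite hcompA h'g.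
Qed.

Lemma cellular_covering (A : tate) k (s : 'I_k -> A) (L : 'I_k -> tate)
    (u : forall i, chom A (L i)) :
  (forall i, is_cellular_loc (u i) (s i)) -> \sum_i s i = 1 ->
  covering (sieve_gen u).
Proof.
move=> us sum1; apply: cov_gen => [i|B f C].
  exact: cellular_open (us i).
have [f1 _] := hom_mul f.
apply: (@cell_cover_sheaf _ _ (fun i => f (s i))).
- by move=> i; rewrite -f1; apply: tle_hom; exact: bloc_contracting (us i).
- by rewrite -hom_sum sum1.
- by move=> D g; split=> -[i ri]; exists i; move/(cellular_factor (us i) (hcomp g f)): ri.
Qed.

Theorem proposition7p9 (A : tate) (k : nat) (S : 'I_k -> A)
    (hS : forall i : 'I_k, S i <=o 1)
    (L : tate) (f : chom A L)
    (hf : is_cellular_loc f (\sum_(i < k) S i))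
    (Li : 'I_k -> tate) (fi : forall i : 'I_k, chom A (Li i))
    (hfi : forall i : 'I_k, is_cellular_loc (fi i) (S i)) :
  is_join (fun U => exists i : 'I_k, U = Spec_open (cellular_open (hfi i)))
          (Spec_open (cellular_open hf)) /\
  open_set (Spec_open (cellular_open hf)) =
    (fun p : Spec_point A =>
       exists i : 'I_k, open_set (Spec_open (cellular_open (hfi i))) p).
Proof.
have [f1 _] := hom_mul f.
have sum_f : \sum_i f (S i) = 1.
  by rewrite -hom_sum; apply/(cellular_factor hf); exists (hid L); exact: hcomp1f.
have fi_f i : exists u : chom L (Li i), hcomp u f = fi i.
  have fiS : fi i (S i) = 1.
    by apply/(cellular_factor (hfi i)); exists (hid _); exact: hcomp1f.
  have [fi1 _] := hom_mul (fi i).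
  apply/(cellular_factor hf); apply: tle_anti.
    by rewrite -fi1; apply: tle_hom; exact: tle_sum.
  by rewrite -fiS; apply: tle_hom; exact: tle_sum_term.
pose u i := sval (cid (fi_f i)).
have uf i : hcomp (u i) f = fi i := svalP (cid (fi_f i)).
have fE := open_immersion_epi (cellular_open hf).
have us i : is_cellular_loc (u i) (f (S i)).
  by apply: cellular_base fE _; rewrite uf.
have cov := cellular_covering us sum_f.
have sub i : subp_le (Spec_open (cellular_open (hfi i))) (Spec_open (cellular_open hf)).
  by move=> B g [[] [h <-]]; exists tt, (hcomp h (u i)); rewrite -hcompA uf.
have join : is_join (fun U => exists i : 'I_k, U = Spec_open (cellular_open (hfi i)))
          (Spec_open (cellular_open hf)).
  split=> [V [i ->]|W leW]; first exact: sub.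
  have [F _ [Wsh _ _]] := os_union W.
  have Wu (D : tate) (g : chom L D) : sieve_gen u D g -> W D (hcomp g f).
    move=> [i [h <-]]; apply: (leW _ (ex_intro _ i erefl)).
    by exists tt, h; rewrite -hcompA uf.
  have [|y [yP _]] := Wsh _ _ cov
      (fun D g r => exist _ (hcomp g f : Spec A D) (Wu D g r)).
    by move=> B C g h r r'; apply: sval_inj; rewrite /= hcompA.
  (* y and f have the same restrictions to the cover, and Spec A is separated. *)
  have yf : sval y = f.
    apply: (sheaf_for_inj (Spec_sheaf (A := A) cov)) => D g r.
    by have /(congr1 (@sval (Spec A D) (W D))) := yP D g r.
  move=> B g [[] [h <-]]; rewrite -yf.
  exact: (@sp_stable _ W _ _ h (sval y) (svalP y)).
split=> //; apply/funext => p; apply/propext; split.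
  by move=> /(pt_prime join) [V [i ->]]; exists i.
by move=> [i]; exact: pt_upward.
Qed.
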